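(* Let $G$ be a connected planar graph. (1) Every polyhedral embedding of $G$ in an orientable surface has genus $0$; that is, $G$ has no polyhedral embedding in any orientable surface but the plane. (2) If $G$ is cubic, then every embedding of $G$ in an orientable surface whose dual graph is simple has genus $0$; that is, cubic planar graphs have no embedding with a simple dual in any orientable surface but the plane.
   Context: Graphs are finite, simple and undirected. A graph is cubic if every vertex has degree $3$. Embeddings in orientable surfaces are described combinatorially (they correspond to 2-cell embeddings). Each undirected edge $\{u,v\}$ is interpreted as two directed edges $e=(u,v)$ and $e^{-1}=(v,u)$. An embedding of a graph is a choice, for every vertex $u$, of a cyclic order of all directed edges $(u,\cdot)$ starting at $u$ (interpreted as clockwise order). For a directed edge $e$, $\mathrm{nx}(e)$ denotes the next edge after $e$ in the cyclic order around the starting vertex of $e$. A face of an embedding is a directed cyclic walk $e_0,\dots,e_{n-1}$ with $\mathrm{nx}(e_i^{-1})=e_{(i+1) \bmod n}$ for all $0\le i<n$; i.e. the faces are the orbits of the permutation $e\mapsto \mathrm{nx}(e^{-1})$ on directed edges. (By convention, the one-vertex graph has exactly one face, the trivial walk, which is not a simple cycle.) The genus of an embedding of a connected graph with $v$ vertices, $e$ undirected edges and $f$ faces is $\gamma=\frac{2-(v-e+f)}{2}$; an embedding of genus $0$ is an embedding in the plane. A graph is planar if it has an embedding of genus $0$. A polyhedral embedding of a graph in an orientable surface is an embedding such that each facial walk is a simple cycle and the intersection of any two distinct faces (as subgraphs, i.e. their common vertices and edges) is either empty, a single vertex, or a single edge (with its two endpoints). The dual graph of an embedding has the faces as vertices and,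 for each undirected edge of $G$ with directed versions $e,e^{-1}$, one edge joining the face containing $e$ to the face containing $e^{-1}$. It is simple if it has no loops and no multiple edges. *)

(* Defs.v *)
From mathcomp Require Import all_boot all_order all_algebra all_fingroup.
Set Implicit Arguments.
Unset Strict Implicit.
Unset Printing Implicit Defensive.
Import GRing.Theory.

Record sgraph := SGraph {
  vertex :> finType;
  adj : rel vertex;
  adj_sym : symmetric adj;
  adj_irr : irreflexive adj
}.

Definition connected_graph (G : sgraph) : Prop :=
  0 < #|G| /\ forall x y : G, connect (@adj G) x y.

Definition cubic (G : sgraph) : Prop :=
  forall x : G, #|[set y | adj x y]| = 3.

(* A dart is a directed edge. *)
Definition dart (G : sgraph) : finType := {d : G * G | adj d.1 d.2}.

Section Darts.
Variable G : sgraph.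
Implicit Type d : dart G.

Definition dart_start d : G := (val d).1.
Definition dart_target d : G := (val d).2.

Fact dart_rev_subproof d : adj (dart_target d) (dart_start d).
Proof. by rewrite adj_sym; exact: (valP d). Qed.

Definition dart_rev d : dart G :=
  exist (fun p : G * G => adj p.1 p.2)
        (dart_target d, dart_start d) (dart_rev_subproof d).

Lemma dart_revK : involutive dart_rev.
Proof. by case=> [[x y] xy]; apply: val_inj. Qed.

Definition rev_perm : {perm dart G} := perm (inv_inj dart_revK).

Definition dart_edge d : {set G} := [set dart_start d; dart_target d].

Definition edges : {set {set G}} := [set dart_edge d | d : dart G].

End Darts.

(* The cyclic orders at all vertices are recorded by the single permutation
   nx, whose cycles are exactly the sets of darts with a common start. *)
Record embedding (G : sgraph) := Embedding {
  nx : {perm dart G};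
  nx_porbit : forall d d' : dart G,
    (d' \in porbit nx d) = (dart_start d' == dart_start d)
}.

Section Embeddings.
Variables (G : sgraph) (phi : embedding G).

Definition face_perm : {perm dart G} := (rev_perm G * nx phi)%g.

Lemma face_permE d : face_perm d = nx phi (dart_rev d).
Proof. by rewrite permM permE. Qed.

(* A face is represented by its set of darts; the trivial walk of the
   one-vertex graph is represented by the empty set. *)
Definition faces : {set {set dart G}} :=
  if #|G| == 1 then [set set0] else porbits face_perm.

(* c lists the darts of a face in walk order, from an arbitrary first dart. *)
Definition facial_walk (c : seq (dart G)) : Prop :=
  ufcycle face_perm c /\ [set d in c] \in faces.

Definition genus : rat :=
  ((2 - (#|G|%:R - #|edges G|%:R + #|faces|%:R)) / 2)%R.

End Embeddings.

Definition planar (G : sgraph) : Prop :=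
  exists phi : embedding G, genus phi = 0%R.

Definition simple_cycle (G : sgraph) (c : seq G) : Prop :=
  2 < size c /\ ucycle (@adj G) c.

(* The subgraph underlying a face. For the trivial face the vertex set below
   is empty, but that face is never one of two distinct faces. *)
Definition face_vertices (G : sgraph) (F : {set dart G}) : {set G} :=
  [set dart_start d | d in F].
Definition face_edges (G : sgraph) (F : {set dart G}) : {set {set G}} :=
  [set dart_edge d | d in F].

Definition polyhedral_meet (G : sgraph) (F1 F2 : {set dart G}) : Prop :=
  let V := face_vertices F1 :&: face_vertices F2 in
  let E := face_edges F1 :&: face_edges F2 in
  [\/ V = set0 /\ E = set0,
      exists v : G, V = [set v] /\ E = set0
    | exists u v : G, [/\ adj u v, V = [set u; v] & E = [set [set u; v]]]].

Definition polyhedral (G : sgraph) (phi : embedding G) : Prop :=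
  (forall c, facial_walk phi c -> simple_cycle (map (@dart_start G) c)) /\
  (forall F1 F2, F1 \in faces phi -> F2 \in faces phi -> F1 != F2 ->
     polyhedral_meet F1 F2).

(* Each edge has a set of one (loop) or two end vertices. *)
Record multigraph := Multigraph {
  mvertex : finType;
  medge : finType;
  mends : medge -> {set mvertex}
}.

Definition simple_multigraph (M : multigraph) : Prop :=
  (forall e : medge M, #|mends e| != 1) /\ injective (@mends M).

Definition dual_vertex (G : sgraph) (phi : embedding G) : finType :=
  {F : {set dart G} | F \in faces phi}.

Definition dual_edge (G : sgraph) : finType := {e : {set G} | e \in edges G}.

(* The ends of the dual of an edge {u, v} are the face containing (u, v) and
   the face containing (v, u). *)
Definition dual (G : sgraph) (phi : embedding G) : multigraph :=
  @Multigraph (dual_vertex phi) (dual_edge G)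
    (fun e => [set F : dual_vertex phi |
                [exists d in val F, dart_edge d == val e]]).

(* Main.v *)
Require Import Defs.
From HB Require Import structures.
From mathcomp Require Import all_boot all_order all_algebra all_fingroup.
From mathcomp Require Import zify.
Set Implicit Arguments.
Unset Strict Implicit.
Unset Printing Implicit Defensive.
Import GRing.Theory Num.Theory.

(** In a plane embedding the face boundaries span the cycle space over F_2
    (both have dimension E - V + 1 = F - 1), so every cycle separates the faces
    into two colour classes.  Let C be a facial cycle of an embedding that is
    polyhedral, or cubic with a simple dual.  The other faces of that embedding
    meet C in at most one vertex or edge, so their remaining parts are paths
    avoiding C which chain all edges off C together; hence all darts off C get
    the same colour in the plane.  The faces of the other colour then consist of
    edges of C only, so C, up to direction, is a face of the plane embedding.
    This yields a length-preserving injection between the face sets, which is a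
    bijection because the face lengths sum to 2E in both embeddings.  So the two
    embeddings have the same genus. *)

(** * Orbits of a permutation and induction along walks *)

Section PorbitExtras.
Variables (T : finType) (s : {perm T}).
Implicit Types x y z : T.

Lemma porbit_permT x : s x \in porbit s x.
Proof. by have := mem_porbit s 1 x; rewrite expg1. Qed.

Lemma porbit_permE x y : (s x \in porbit s y) = (x \in porbit s y).
Proof.
by rewrite -!eq_porbit_mem; congr (_ == _); apply/eqP; rewrite eq_porbit_mem porbit_permT.
Qed.

Lemma porbit_permEr x y : (x \in porbit s (s y)) = (x \in porbit s y).
Proof. by rewrite ![x \in _]porbit_sym porbit_permE. Qed.

Lemma porbit_trans y x z : x \in porbit s y -> y \in porbit s z -> x \in porbit s z.
Proof. by rewrite -!eq_porbit_mem => /eqP->. Qed.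

Lemma porbit_euclid z x y : x \in porbit s z -> y \in porbit s z -> x \in porbit s y.
Proof. by rewrite [y \in _]porbit_sym; apply: porbit_trans. Qed.

Lemma porbit_ind (P : T -> Prop) x :
  P x -> (forall y, y \in porbit s x -> P y -> P (s y)) ->
  forall y, y \in porbit s x -> P y.
Proof.
move=> Px Ps y /porbitP[n ->]; elim: n => [|n IHn]; first by rewrite expg0 perm1.
by rewrite expgSr permM; apply: Ps => //; apply: mem_porbit.
Qed.

Lemma partition_porbits : partition (porbits s) [set: T].
Proof.
have -> : porbits s = orbit 'P <[s]> @: [set: T].
  by apply/setP=> A; apply/imsetP/imsetP=> [] [x _ ->]; exists x; rewrite ?porbitE.
by apply: orbit_partition; apply/actsP=> a _ x; rewrite !inE.
Qed.

End PorbitExtras.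

Lemma connect_ind (T : finType) (e : rel T) (P : T -> Prop) x :
  P x -> (forall y z, e y z -> P y -> P z) -> forall y, connect e x y -> P y.
Proof.
move=> Px Pe y /connectP[p xp ->]; elim: p x Px xp => //= z p IHp x Px.
by case/andP=> xz; apply: IHp; apply: Pe Px.
Qed.

(** * Darts, their reversal and the face permutation *)

Section DartBasics.
Variable G : sgraph.
Implicit Types d e : dart G.

Lemma dart_ends_inj d e :
  dart_start d = dart_start e -> dart_target d = dart_target e -> d = e.
Proof.
case: d e => [[x y] xy] [[u v] uv] xu yv; apply: val_inj => /=.
by rewrite /dart_start /dart_target /= in xu yv; rewrite xu yv.
Qed.

Lemma dart_start_neq_target d : dart_start d != dart_target d.
Proof.
apply/eqP=> dd; have := valP d; rewrite /= -/(dart_start d) -/(dart_target d).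
by rewrite dd adj_irr.
Qed.

Lemma dart_edge_rev d : dart_edge (dart_rev d) = dart_edge d.
Proof. by rewrite /dart_edge setUC. Qed.

Lemma dart_rev_neq d : dart_rev d != d.
Proof.
apply: contraNneq (dart_start_neq_target d) => rd.
by rewrite -{1}rd.
Qed.

Lemma dart_edgeP d e :
  (dart_edge d == dart_edge e) = (d == e) || (d == dart_rev e).
Proof.
apply/eqP/orP => [de|[] /eqP->//]; last exact: dart_edge_rev.
have := set21 (dart_start d) (dart_target d).
have := set22 (dart_start d) (dart_target d).
rewrite -/(dart_edge d) de /dart_edge => /set2P td /set2P sd.
move: (dart_start_neq_target d); case: sd td => sE [] tE; rewrite sE tE ?eqxx // => _.
- by left; apply/eqP/dart_ends_inj.
- by right; apply/eqP/dart_ends_inj.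
Qed.

Lemma dart_edge_mem d : dart_edge d \in edges G.
Proof. exact: imset_f. Qed.

Definition edge_of d : dual_edge G := exist _ (dart_edge d) (dart_edge_mem d).

Lemma sum_edge_darts (K : nmodType) (F : dart G -> K) d :
  (\sum_(e | dart_edge e == dart_edge d) F e = F d + F (dart_rev d))%R.
Proof.
rewrite (bigD1 d) //=; congr (_ + _)%R; rewrite (big_pred1 (dart_rev d)) // => e.
rewrite dart_edgeP; have [->|_] /= := eqVneq e d; last by rewrite andbT.
by rewrite eq_sym (negPf (dart_rev_neq d)).
Qed.

Section Emb.
Variable phi : embedding G.
Local Notation fp := (face_perm phi).

Lemma dart_start_nx d : dart_start (nx phi d) = dart_start d.
Proof. by apply/eqP; rewrite -(nx_porbit phi) porbit_permT. Qed.

Lemma dart_start_face_perm d : dart_start (fp d) = dart_target d.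
Proof. by rewrite face_permE dart_start_nx. Qed.

Lemma face_perm_rev d : fp (dart_rev d) = nx phi d.
Proof. by rewrite face_permE dart_revK. Qed.

Lemma facesE : #|G| != 1 -> faces phi = porbits fp.
Proof. by rewrite /faces => /negPf->. Qed.

End Emb.

Lemma cards1_no_dart : #|G| = 1 -> dart G -> False.
Proof.
move=> G1 d; have [x Gx] := mem_card1 G1.
have := dart_start_neq_target d.
have := Gx (dart_start d); have := Gx (dart_target d); rewrite !inE.
by move=> /esym/eqP-> /esym/eqP->; rewrite eqxx.
Qed.

Lemma genus_card1 (phi : embedding G) : #|G| = 1 -> genus phi = 0%R.
Proof.
move=> G1; rewrite /genus /faces G1 eqxx cards1.
suff -> : edges G = set0 by rewrite cards0.
apply/setP=> e; rewrite inE; apply/imsetP=> [] [d _ _].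
exact: cards1_no_dart d.
Qed.

Lemma connected_ex_dart (u : G) : connected_graph G -> #|G| != 1 ->
  exists d : dart G, dart_start d = u.
Proof.
case=> G0 conn G1.
have [v uv] : exists v : G, v != u.
  apply/existsP; apply: contraNT G1; rewrite negb_exists => /forallP Gu.
  apply/eqP/(@eq_card1 _ u) => v; have := Gu v; rewrite negbK => /eqP->.
  by rewrite [RHS]inE eqxx.
have /connectP[[|w p] /=] := conn u v; first by move=> _ vu; rewrite vu eqxx in uv.
by case/andP=> uw _ _; exists (exist (fun p => adj p.1 p.2) (u, w) uw).
Qed.

End DartBasics.

(** * The mod-2 chain complex of an embedding and colourings of plane faces *)

Section CycleSpace.
Variables (G : sgraph) (psi : embedding G).
Hypotheses (conn : connected_graph G) (G_neq1 : #|G| != 1).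
Local Notation fp := (face_perm psi).
Local Notation K := 'F_2.
Local Open Scope ring_scope.
Implicit Types d e : dart G.

Lemma face_of_subproof d : porbit fp d \in faces psi.
Proof. by rewrite facesE // imset_f. Qed.

Definition face_of d : dual_vertex psi := exist _ (porbit fp d) (face_of_subproof d).

Lemma face_ofP (F : dual_vertex psi) : exists d, F = face_of d.
Proof.
case: F => F FF; have /imsetP[d _ Fd] : F \in porbits fp by rewrite -facesE.
by exists d; apply: val_inj.
Qed.

Lemma face_of_eq d e : (face_of d == face_of e) = (d \in porbit fp e).
Proof. by rewrite -eq_porbit_mem; apply/eqP/eqP=> [[]|de] //; apply: val_inj. Qed.

Lemma face_of_perm d : face_of (fp d) = face_of d.
Proof. by apply/eqP; rewrite face_of_eq porbit_permT. Qed.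

(** The boundary operator from 2-chains to 1-chains. Summing over both darts of an edge makes an
    edge with the same face on both sides count twice, hence 0 in ['F_2]. *)
Definition face_bd (s : {ffun dual_vertex psi -> K^o}) : {ffun dual_edge G -> K^o} :=
  [ffun e => \sum_(d | dart_edge d == val e) s (face_of d)].

Definition edge_bd (x : {ffun dual_edge G -> K^o}) : {ffun G -> K^o} :=
  [ffun v => \sum_(d | dart_start d == v) x (edge_of d)].

Lemma face_bd_linear : linear face_bd.
Proof.
move=> a s t; apply/ffunP=> e; rewrite !ffunE.
by rewrite scaler_sumr -big_split; apply: eq_bigr => d _; rewrite !ffunE.
Qed.
HB.instance Definition _ := GRing.isLinear.Build K _ _ _ face_bd face_bd_linear.

Lemma edge_bd_linear : linear edge_bd.
Proof.
move=> a s t; apply/ffunP=> e; rewrite !ffunE.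
by rewrite scaler_sumr -big_split; apply: eq_bigr => d _; rewrite !ffunE.
Qed.
HB.instance Definition _ := GRing.isLinear.Build K _ _ _ edge_bd edge_bd_linear.

Lemma face_bdE s d :
  face_bd s (edge_of d) = s (face_of d) + s (face_of (dart_rev d)).
Proof. by rewrite ffunE sum_edge_darts. Qed.

(** At a vertex the sum splits into one over [d] and one over [dart_rev d]. Since [nx psi d] and
    [dart_rev d] lie on a common face, reindexing the first by [nx psi] makes the two equal, and
    they cancel in characteristic 2. *)
Lemma edge_face_bd s : edge_bd (face_bd s) = 0.
Proof.
apply/ffunP=> v; rewrite !ffunE.
under eq_bigr => d _ do rewrite face_bdE.
rewrite big_split /= [X in X + _](reindex_inj (@perm_inj _ (nx psi))) /=.
under eq_bigl => d do rewrite dart_start_nx.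
under eq_bigr => d _ do rewrite -face_perm_rev face_of_perm.
by rewrite (addrr_pchar2 (pchar_Fp _)).
Qed.

(** By rank-nullity it suffices that the kernel has dimension at most 1. A kernel element agrees on
    the two sides of every edge, so it is constant around each vertex, and by connectivity
    everywhere. *)
Lemma dim_face_bd : (#|faces psi| <= (\dim (limg (linfun face_bd))).+1)%N.
Proof.
have := limg_ker_dim (linfun face_bd) fullv.
rewrite capfv dimvf /dim /= muln1 card_sig => /esym.
have -> : #|[pred F | F \in faces psi]| = #|faces psi| by apply: eq_card.
move=> ->; rewrite -[X in (_ <= X)%N]add1n leq_add2r.
suff kW : (lker (linfun face_bd) <= <[ ([ffun=> 1%R] : {ffun dual_vertex psi -> K^o}) ]>)%VS.
  by apply: leq_trans (dimvS kW) _; rewrite dim_vline; case: (_ != _).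
apply/subvP=> s; rewrite memv_ker lfunE /= => /eqP s0.
have srev d : s (face_of (dart_rev d)) = s (face_of d).
  have /eqP := face_bdE s d; rewrite s0 ffunE eq_sym.
  by rewrite -[X in X + _]opprK (oppr_pchar2 (pchar_Fp _)) // addrC subr_eq0 => /eqP.
have snx d : s (face_of (nx psi d)) = s (face_of d).
  by rewrite -face_perm_rev face_of_perm srev.
have sv d e : dart_start e = dart_start d -> s (face_of e) = s (face_of d).
  move/eqP; rewrite -(nx_porbit psi) => de.
  by elim/porbit_ind: e / de => // e _; rewrite snx.
have [/card_gt0P[u _] uconn] := conn.
have [d0 d0u] := connected_ex_dart u conn G_neq1.
apply/vlineP; exists (s (face_of d0)); apply/ffunP=> F.
have [d ->] := face_ofP F; rewrite !ffunE /GRing.scale /= mulr1.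
suff P v : connect (@adj G) u v -> forall d, dart_start d = v -> s (face_of d) = s (face_of d0).
  exact: P (uconn u (dart_start d)) d erefl.
elim/connect_ind: v / => [e eu|y z yz IH e ez]; first by apply: sv; rewrite eu.
pose a : dart G := exist (fun p => adj p.1 p.2) (y, z) yz.
by rewrite (@sv (dart_rev a)) ?srev ?IH.
Qed.

(** The image together with a single [delta u] spans all 0-chains: along a walk from [u], each edge
    yields the next [delta] from the previous one. *)
Lemma dim_edge_bd : (#|G| <= (\dim (limg (linfun edge_bd))).+1)%N.
Proof.
have [/card_gt0P[u _] uconn] := conn.
pose delta (v : G) : {ffun G -> K^o} := [ffun w => (w == v)%:R].
pose W := (limg (linfun edge_bd) + <[delta u]>)%VS.
have dW v : delta v \in W.
  have := uconn u v; elim/connect_ind: v / => [|y z yz yW].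
    by rewrite memvE addvSr.
  pose a : dart G := exist (fun p => adj p.1 p.2) (y, z) yz.
  pose x : {ffun dual_edge G -> K^o} := [ffun e => (e == edge_of a)%:R].
  (* The boundary of the single edge [a] is [delta y + delta z]. *)
  suff -> : delta z = linfun edge_bd x - delta y.
    by rewrite rpredB // memvE (subv_trans _ (addvSl _ _)) // -memvE memv_img ?memvf.
  rewrite lfunE /=; apply/eqP; rewrite eq_sym subr_eq; apply/eqP/ffunP=> w; rewrite !ffunE.
  under eq_bigr => d _ do rewrite ffunE.
  rewrite big_mkcond /= (eq_bigr (fun d =>
    if dart_edge d == dart_edge a then (w == dart_start d)%:R else 0)); last first.
    by move=> d _; rewrite [w == _]eq_sym -[_ == edge_of a]val_eqE /=; do 2!case: (_ == _).
  by rewrite -big_mkcond sum_edge_darts addrC.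
have <- : \dim {:{ffun G -> K^o}} = #|G| by rewrite dimvf /dim /= muln1.
have /dimvS : (fullv <= W)%VS.
  apply/subvP=> f _; suff -> : f = \sum_v f v *: delta v.
    by apply: memv_suml => v _; rewrite memvZ.
  apply/ffunP=> w; rewrite sum_ffunE (bigD1 w) //= big1 => [|v vw]; rewrite !ffunE.
    by rewrite eqxx addr0 /GRing.scale /= mulr1.
  by rewrite eq_sym (negPf vw) scaler0.
move/leq_trans; apply; apply: leq_trans (dimv_add_leqif _ _) _.
by rewrite dim_vline; case: (_ != _); rewrite ?addn1 ?addn0 ?leqnSn.
Qed.

Hypothesis psi_plane : genus psi = 0.

Lemma plane_Euler : (#|G| + #|faces psi| = #|edges G| + 2)%N.
Proof.
have /eqP := psi_plane; rewrite /genus mulf_eq0 invr_eq0 orbF.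
rewrite subr_eq0 addrAC eq_sym subr_eq -!natrD eqr_nat => /eqP->.
by rewrite addnC.
Qed.

(** One inclusion is [edge_face_bd]. For the dimensions, the kernel has dimension at most E - V + 1,
    which by Euler's formula is F - 1, a lower bound for the dimension of the image. *)
Lemma face_bd_span_cycles : limg (linfun face_bd) = lker (linfun edge_bd).
Proof.
apply/eqP; rewrite eqEdim; apply/andP; split.
  apply/subvP=> _ /memv_imgP[s _ ->].
  by rewrite memv_ker !lfunE /= edge_face_bd.
have := limg_ker_dim (linfun edge_bd) fullv.
rewrite capfv dimvf /dim /= muln1 card_sig.
have -> : #|[pred e | e \in edges G]| = #|edges G| by apply: eq_card.
have := plane_Euler; have := dim_edge_bd; have := dim_face_bd.
move: (\dim _) (\dim _) (\dim _) => a b c; lia.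
Qed.

(** An edge set of even degree at every vertex is a mod-2 cycle, hence the boundary of a set of
    faces; [col] tells whether the face of a dart belongs to that set. *)
Lemma plane_coboundary (x : {set dart G}) :
  (forall d, (dart_rev d \in x) = (d \in x)) ->
  (forall v, ~~ odd #|[set d in x | dart_start d == v]|) ->
  exists col : pred (dart G), (forall d, col (fp d) = col d) /\
    forall d, (col d (+) col (dart_rev d)) = (d \in x).
Proof.
move=> xrev xeven.
pose X : {ffun dual_edge G -> K^o} :=
  [ffun e => [exists d in x, edge_of d == e]%:R].
have XE d : X (edge_of d) = (d \in x)%:R.
  rewrite ffunE; congr (_%:R); congr (nat_of_bool _).
  apply/exists_inP/idP=> [[e ex]|dx]; last by exists d.
  by rewrite -val_eqE /= dart_edgeP => /orP[] /eqP ed; rewrite ed ?xrev in ex.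
have : X \in limg (linfun face_bd).
  rewrite face_bd_span_cycles memv_ker lfunE /=; apply/eqP/ffunP=> v; rewrite !ffunE.
  under eq_bigr => d _ do rewrite XE.
  rewrite -natr_sum -big_mkcondr /= sum1_card.
  apply/eqP; rewrite -(dvdn_pcharf (pchar_Fp _)) // dvdn2.
  by rewrite (eq_card (B := [set d in x | dart_start d == v])) // => d; rewrite !inE andbC.
case/memv_imgP=> s _; rewrite lfunE /= => Xs.
exists (fun d => s (face_of d) != 0); split=> d; first by rewrite face_of_perm.
have := face_bdE s d; rewrite -Xs XE.
by case: (d \in x); case: (s _) => [[|[|[]]]] // ?; case: (s _) => [[|[|[]]]] // ?.
Qed.

End CycleSpace.

(** * Tame embeddings and two-colourings off one facial cycle *)

Section Tame.
Variables (G : sgraph) (phi : embedding G).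
Local Notation fp := (face_perm phi).
Implicit Types d e f : dart G.

(** The undirected edge set of the facial walk through [f], as a set of darts closed under
    reversal. *)
Definition along f d := (d \in porbit fp f) || (dart_rev d \in porbit fp f).

(* Implied both by polyhedrality and, for cubic graphs, by a simple dual.  In
   [tame_edge], the two faces of [d] share no second edge; in [tame_meet], a face
   leaves the cycle of another one at most once along an edge off that cycle. *)
Record tame : Prop := Tame {
  tame_no_loop : forall d, dart_rev d \notin porbit fp d;
  tame_simple : forall d e,
    e \in porbit fp d -> dart_start e = dart_start d -> e = d;
  tame_edge : forall d e,
    e \in porbit fp d -> dart_rev e \in porbit fp (dart_rev d) -> e = d;
  tame_meet : forall f f' d d',
    f' \in porbit fp f -> d' \in porbit fp d ->
    dart_start f = dart_start d -> dart_start f' = dart_start d' ->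
    ~~ along f d -> ~~ along f d' -> d' = d
}.

Lemma along_rev f d : along f (dart_rev d) = along f d.
Proof. by rewrite /along dart_revK orbC. Qed.

Lemma along_porbit f f' d : f' \in porbit fp f -> along f' d = along f d.
Proof. by rewrite -eq_porbit_mem /along => /eqP->. Qed.

Hypothesis phi_tame : tame.

(** A simple facial cycle passes each of its vertices once, so only two of its edges meet there. *)
Lemma along_start f d : dart_start d = dart_target f -> along f d ->
  d = fp f \/ d = dart_rev f.
Proof.
move=> df /orP[dF|dF].
  by left; apply: (tame_simple phi_tame); rewrite ?dart_start_face_perm ?porbit_permEr.
right; apply: (can_inj (@dart_revK G)); rewrite dart_revK; apply: (@perm_inj _ fp).
by apply: (tame_simple phi_tame); rewrite ?porbit_permE ?porbit_permEr // !dart_start_face_perm.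
Qed.

Section OneFace.
Variables (f0 : dart G) (col : pred (dart G)).
Local Notation F := (porbit fp f0).
Local Notation X := (along f0).
Local Notation onF v := [exists f in F, dart_start f == v].

(** These two properties will be supplied by a plane colouring that changes exactly across the cycle
    of [f0]. *)
Hypothesis col_rev : forall d, ~~ X d -> col (dart_rev d) = col d.
Hypothesis col_turn : forall d e, dart_start d = dart_start e ->
  ~~ onF (dart_start d) -> col d = col e.

Lemma along_onF d : X d -> onF (dart_start d) && onF (dart_target d).
Proof.
wlog dF : d / d \in F => [wl Xd|_].
  case/orP: (Xd) => [/wl/(_ Xd)//|/wl]; rewrite along_rev andbC; exact.
apply/andP; split; apply/exists_inP; first by exists d.
by exists (fp d); rewrite ?porbit_permE // dart_start_face_perm.
Qed.

(* A face other than [f0]'s touches the cycle at most once off its edges, so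
   its remaining part is a path in the complement of the cycle. *)
Lemma col_face d e : e \in porbit fp d -> ~~ X d -> ~~ X e -> col e = col d.
Proof.
(* One may start at the dart where the face leaves the cycle, unique by [tame_meet]. If there is no
   such dart, [base] holds vacuously for any [d]; otherwise [d] and [e] are both compared with
   it. *)
wlog base : d e / forall a, a \in porbit fp d -> ~~ X a -> onF (dart_start a) -> a = d.
  move=> wl ed Xd Xe.
  have [/exists_inP[b bd /andP[Xb bF]]|noB] :=
      boolP [exists b in porbit fp d, ~~ X b && onF (dart_start b)]; last first.
    apply: wl => // a ad Xa aF; case/negP: noB.
    by apply/exists_inP; exists a; rewrite // Xa aF.
  have base a : a \in porbit fp b -> ~~ X a -> onF (dart_start a) -> a = b.
    move=> ab Xa /exists_inP[f' f'F /eqP f'a].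
    case/exists_inP: bF => f fF /eqP fb.
    apply: (tame_meet phi_tame _ ab fb f'a); rewrite ?(along_porbit _ fF) //.
    exact: porbit_euclid f'F fF.
  by rewrite (wl b e) ?(wl b d) //; [rewrite porbit_sym | exact: porbit_euclid ed bd].
(* Walk along the face: a later dart off the cycle starts at a vertex off the cycle, so its
   predecessor is off the cycle too and passes its colour on. *)
move=> ed Xd; elim/porbit_ind: e / ed => // e ed IH Xfe.
have [/(base _ _ Xfe) ->//|nF] := boolP (onF (dart_start (fp e))).
  by rewrite porbit_permE.
have Xe : ~~ X e.
  by apply: contra nF => /along_onF/andP[_]; rewrite dart_start_face_perm.
by rewrite -(IH Xe) -(col_rev Xe); apply: (col_turn _ nF); rewrite dart_start_face_perm.
Qed.

(** At a vertex of the cycle, the darts off it are consecutive in the rotation of [phi]. For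
    consecutive [a] and [nx phi a], the darts [dart_rev a] and [nx phi a] share a face, so
    [col_face] applies. *)
Lemma col_vertex d e : dart_start d = dart_start e -> ~~ X d -> ~~ X e -> col d = col e.
Proof.
move=> de Xd Xe.
have [|nF] := boolP (onF (dart_start d)); last exact: col_turn.
case/exists_inP=> f fF /eqP fd.
(* The other cycle dart at this vertex; it immediately precedes [f] in the rotation. *)
pose p := dart_rev ((fp^-1)%g f).
have pf : fp (dart_rev p) = f by rewrite dart_revK permKV.
have Xf : X f by rewrite /along fF.
have Xstart a : dart_start a = dart_start f -> X a -> a = f \/ a = p.
  rewrite -pf dart_start_face_perm -(@along_porbit f0 (dart_rev p)).
    by move=> ap /(along_start ap); rewrite dart_revK.
  by rewrite -porbit_permE pf.
(* The rotation is followed from [nx phi f]; the block of darts off the cycle ends at [p], whose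
   successor is again [f]. *)
suff base a : dart_start a = dart_start f -> ~~ X a -> col a = col (nx phi f).
  by rewrite !base // ?fd // -de.
move/eqP; rewrite -(nx_porbit phi) -porbit_permEr => af.
elim/porbit_ind: a / af => // a; rewrite porbit_permEr nx_porbit => /eqP af IH Xna.
have [/(Xstart _ af)[->//|ap]|Xa] := boolP (X a).
  by case/negP: Xna; rewrite ap -face_perm_rev pf.
rewrite -(IH Xa) -(col_rev Xa) -face_perm_rev.
by apply: col_face; rewrite ?along_rev ?face_perm_rev // -?face_perm_rev ?porbit_permT.
Qed.

(** A detour around an edge of the cycle: the face on its other side meets the cycle in no other
    edge, so the neighbours of [dart_rev f] on that face are off the cycle and have the same
    colour. *)
Lemma col_step f : f \in F -> exists p q, [/\ ~~ X p, ~~ X q, col p = col q,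
  dart_start p = dart_target f & dart_start q = dart_start f].
Proof.
move=> fF; pose p := (fp^-1)%g (dart_rev f); pose q := fp (dart_rev f).
have pf : fp p = dart_rev f by rewrite permKV.
have nof d : d \in porbit fp (dart_rev f) -> d \notin F.
  move=> df; apply: contra (tame_no_loop phi_tame f) => dF.
  by rewrite porbit_sym; apply: porbit_trans (porbit_euclid fF dF) df.
have pH : p \in porbit fp (dart_rev f) by rewrite -porbit_permE pf porbit_id.
have qH : q \in porbit fp (dart_rev f) by apply: porbit_permT.
have rF d : d \in porbit fp (dart_rev f) -> X d -> d = dart_rev f.
  move=> dH /orP[dF|dF]; first by case/negP: (nof _ dH).
  apply: (can_inj (@dart_revK G)); rewrite dart_revK.
  apply: (tame_edge phi_tame); rewrite ?dart_revK //.
  exact: porbit_euclid dF fF.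
have fp_neq d : fp d != d.
  apply: contraNneq (dart_start_neq_target d) => dd.
  by rewrite -(dart_start_face_perm phi) dd.
have Xp : ~~ X p.
  by apply: contra (fp_neq p) => /(rF _ pH) pE; rewrite pf pE.
have Xq : ~~ X q.
  by apply: contra (fp_neq (dart_rev f)) => /(rF _ qH) qE; rewrite -/q qE.
exists (dart_rev p), q; rewrite along_rev; split=> //.
- by rewrite col_rev //; apply: col_face => //; exact: porbit_euclid pH qH.
- by rewrite -[LHS]/(dart_target p) -(dart_start_face_perm phi) pf.
- by rewrite dart_start_face_perm.
Qed.

(** The colour spreads along walks in [G]: across an edge off the cycle by [col_rev], past an edge
    of the cycle by [col_step], and within a vertex by [col_vertex]. *)
Lemma col_constant : connected_graph G ->
  exists a, forall d, ~~ X d -> col d = a.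
Proof.
case=> _ conn; have [d0 Xd0|noX] := pickP (fun d => ~~ X d); last first.
  by exists true => d; rewrite noX.
exists (col d0) => d Xd.
have := conn (dart_start d0) (dart_start d).
suff P v : connect (@adj G) (dart_start d0) v ->
  forall e, dart_start e = v -> ~~ X e -> col e = col d0.
  by move/P; apply.
elim/connect_ind: v / => [e ed Xe|y z yz IH e ez Xe]; first exact: col_vertex.
pose a : dart G := exist (fun p => adj p.1 p.2) (y, z) yz.
have [/orP[/col_step|/col_step]|Xa] := boolP (X a).
- case=> p [q [Xp Xq pq ps qs]].
  by rewrite (@col_vertex e p) ?pq ?IH // ez ps.
- case=> p [q [Xp Xq pq ps qs]].
  by rewrite (@col_vertex e q) -?pq ?IH // ez qs.
by rewrite (@col_vertex e (dart_rev a)) ?along_rev ?col_rev ?IH.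
Qed.

End OneFace.
End Tame.

(** * Orbits of permutations that agree on an invariant set, and of conjugates *)

Section PorbitTransfer.
Variable T : finType.
Implicit Types s t : {perm T}.

Lemma eq_porbit_on s t (P : pred T) x : P x ->
  (forall y, P y -> s y = t y /\ P (s y)) -> porbit s x = porbit t x.
Proof.
move=> Px Pst.
have st n : (s ^+ n)%g x = (t ^+ n)%g x /\ P ((s ^+ n)%g x).
  elim: n => [|n [IH Pn]]; first by rewrite !expg0 perm1.
  by rewrite !expgSr !permM -IH; have [<-] := Pst _ Pn.
by apply/setP=> y; apply/porbitP/porbitP=> -[n ->]; exists n; have [] := st n.
Qed.

Lemma porbit_conj s r x : porbit (s ^ r)%g (r x) = r @: porbit s x.
Proof.
apply/setP=> y; apply/porbitP/imsetP=> [[n ->]|[_ /porbitP[n ->] ->]].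
  by exists ((s ^+ n)%g x); rewrite ?mem_porbit // -conjXg permJ.
by exists n; rewrite -conjXg permJ.
Qed.

End PorbitTransfer.

(** * Faces of a tame embedding compared with those of a plane embedding *)

Section Main.
Variables (G : sgraph) (phi psi : embedding G).
Hypotheses (conn : connected_graph G) (G_neq1 : #|G| != 1).
Hypotheses (psi_plane : genus psi = 0%R) (phi_tame : tame phi).
Implicit Types d e f : dart G.
Local Notation fp := (face_perm phi).
Local Notation fq := (face_perm psi).

(** The cycle darts at [v] are those leaving [v] along the face and the reversals of those entering.
    These two sets are disjoint, and [nx phi] maps the second onto the first. *)
Lemma card_along_start f0 v : ~~ odd #|[set d in [set d | along phi f0 d] | dart_start d == v]|.
Proof.
pose A := [set d in porbit fp f0 | dart_start d == v].
pose B := [set d | (dart_rev d \in porbit fp f0) && (dart_start d == v)].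
have -> : [set d in [set d | along phi f0 d] | dart_start d == v] = A :|: B.
  by apply/setP=> d; rewrite !inE /along -andb_orl.
have AB : A :&: B = set0.
  apply/setP=> d; rewrite !inE; apply/negP=> /andP[/andP[dF _] /andP[rF _]].
  by case/negP: (tame_no_loop phi_tame d); apply: porbit_euclid rF dF.
have nxB : nx phi @: B = A.
  apply/setP=> d; apply/imsetP/idP=> [[e eB ->]|].
    by move: eB; rewrite !inE dart_start_nx -face_perm_rev porbit_permE.
  rewrite inE => /andP[dF dv]; exists ((nx phi)^-1 d)%g; last by rewrite permKV.
  by rewrite inE -porbit_permE face_perm_rev -(dart_start_nx phi) permKV dF.
rewrite -[#|_|]addn0 -(cards0 (dart G)) -AB cardsUI -nxB card_imset ?addnn ?odd_double //.
exact: perm_inj.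
Qed.

(** A fixed dart would be the only one at its start; then [nx phi] fixes it as well, and its edge
    has the same [phi]-face on both sides. *)
Lemma nx_neq d : nx psi d != d.
Proof.
apply/eqP=> dd; case/negP: (tame_no_loop phi_tame (dart_rev d)).
rewrite dart_revK -porbit_permEr face_perm_rev.
have : nx phi d \in porbit (nx psi) d by rewrite nx_porbit dart_start_nx.
suff P e : e \in porbit (nx psi) d -> e = d by move/P->; apply: porbit_id.
by elim/porbit_ind: e / => // e _ ->.
Qed.

Lemma tame_face_plane f0 :
  porbit fp f0 \in porbits fq \/ @dart_rev G @: porbit fp f0 \in porbits fq.
Proof.
have [|v|col [colf colx]] := @plane_coboundary G psi conn G_neq1 psi_plane [set d | along phi f0 d].
- by move=> d; rewrite !inE along_rev.
- exact: card_along_start.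
have col_rev d : ~~ along phi f0 d -> col (dart_rev d) = col d.
  by move=> Xd; move: (colx d); rewrite inE (negPf Xd); do 2!case: (col _).
have col_turn d e : dart_start d = dart_start e ->
    ~~ [exists f in porbit fp f0, dart_start f == dart_start d] -> col d = col e.
  move=> /esym/eqP; rewrite -(nx_porbit psi) => ed nF.
  elim/porbit_ind: e / ed => // e; rewrite nx_porbit => /eqP ed ->.
  rewrite -face_perm_rev colf col_rev //; apply: contra nF => /along_onF/andP[].
  by rewrite ed.
have [a colE] := col_constant phi_tame col_rev col_turn conn.
(* The darts on plane faces of the exceptional colour; they form a union of orbits of [fq] inside
   the cycle. *)
pose D d := col d != a.
have DX d : D d -> along phi f0 d by apply: contraNT => /colE->.
have Dq d : D d -> D (fq d) by rewrite /D colf.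
have qrev d : fq d != dart_rev d by rewrite face_permE nx_neq.
(* The colour changes across the edge of [f0], so exactly one of its two darts differs from [a]. *)
have [Df|Df] : D f0 \/ D (dart_rev f0).
  have := colx f0; rewrite inE /along porbit_id /D /=.
  by move=> cc; apply/orP; move: cc; case: (col f0); case: (col _); case: (a).
- left; suff -> : porbit fp f0 = porbit fq f0 by apply: imset_f.
  apply/esym/(@eq_porbit_on _ _ _ [pred d | D d & d \in porbit fp f0]) => [|d /andP[Dd dF]].
    by rewrite inE Df porbit_id.
  (* At the end of [d] the cycle offers only [fp d] and [dart_rev d], and [nx_neq] excludes turning
     back. *)
  suff qd : fq d = fp d by rewrite inE Dq // qd porbit_permE.
  have := DX _ (Dq _ Dd); rewrite -(along_porbit _ dF).
  case/(along_start phi_tame (dart_start_face_perm psi d)) => // /eqP.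
  by rewrite (negPf (qrev d)).
(* Conjugating the inverse of [fp] by reversal gives the permutation that traverses every face of
   [phi] backwards. *)
- right; pose r := rev_perm G; pose s := (fp^-1 ^ r)%g.
  have rE d : r d = dart_rev d by rewrite permE.
  have -> : @dart_rev G @: porbit fp f0 = porbit s (dart_rev f0).
    by rewrite -rE porbit_conj porbitV; apply: eq_imset => d; rewrite rE.
  suff -> : porbit s (dart_rev f0) = porbit fq (dart_rev f0) by apply: imset_f.
  apply/esym/(@eq_porbit_on _ _ _ [pred d | D d & dart_rev d \in porbit fp f0])
    => [|d /andP[Dd dF]].
    by rewrite inE Df dart_revK porbit_id.
  pose g := (fp^-1)%g (dart_rev d).
  have gd : fp g = dart_rev d by rewrite permKV.
  have gF : g \in porbit fp f0 by rewrite -porbit_permE gd.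
  suff qd : fq d = dart_rev g.
    rewrite inE Dq // qd dart_revK; split=> //.
    by rewrite -[X in s X]dart_revK -[X in s X]rE permJ rE.
  have := DX _ (Dq _ Dd); rewrite -(along_porbit _ gF).
  have sg : dart_start (fq d) = dart_target g.
    by rewrite dart_start_face_perm -(dart_start_face_perm phi g) gd.
  by case/(along_start phi_tame sg) => //; rewrite gd => /eqP; rewrite (negPf (qrev d)).
Qed.

(** The map [g] is injective and preserves lengths. In both embeddings the lengths add up to the
    number of darts and are positive, so no plane face is missed. *)
Lemma tame_card_faces : #|faces phi| = #|faces psi|.
Proof.
rewrite !facesE //.
pose g (F : {set dart G}) := if F \in porbits fq then F else @dart_rev G @: F.
have gP F : F \in porbits fp -> g F \in porbits fq.
  case/imsetP=> f _ ->; rewrite /g; case: ifP => // /negP nF.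
  by case: (tame_face_plane f).
have gC F : #|g F| = #|F|.
  by rewrite /g; case: ifP => // _; rewrite card_imset //; apply: inv_inj (@dart_revK G).
(* Otherwise [d] and [fp d] are on one face and their reversals on another, so [tame_edge] forces
   [fp d = d], impossible without loops. *)
have revF d e : porbit fp d <> @dart_rev G @: porbit fp e.
  move=> de.
  have /imsetP[f fe df] : d \in @dart_rev G @: porbit fp e by rewrite -de porbit_id.
  have /imsetP[f' f'e df'] : fp d \in @dart_rev G @: porbit fp e by rewrite -de porbit_permT.
  have ff' : f' = f.
    apply: (tame_edge phi_tame); first exact: porbit_euclid f'e fe.
    by rewrite -df -df' porbit_permT.
  have := dart_start_neq_target d.
  by rewrite -(dart_start_face_perm phi) df' ff' -df eqxx.
have ginj : {in porbits fp &, injective g}.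
  move=> _ _ /imsetP[d _ ->] /imsetP[e _ ->]; rewrite /g.
  case: ifP => _; case: ifP => _ //; first by move/revF.
    by move/esym/revF.
  by move/(imset_inj (inv_inj (@dart_revK G))).
have sub : g @: porbits fp \subset porbits fq.
  by apply/subsetP=> _ /imsetP[F /gP gF ->].
rewrite -(card_in_imset ginj); apply: eq_card => F.
apply/idP/idP => [/(subsetP sub)//|Fq]; apply: contraT => nF.
have gS : \sum_(A in g @: porbits fp) #|A| = \sum_(A in porbits fp) #|A|.
  by rewrite big_imset //=; apply: eq_bigr => A _; apply: gC.
have /eqP := card_partition (partition_porbits fq).
rewrite (card_partition (partition_porbits fp)) [X in _ == X](big_setID (g @: porbits fp)) /=.
rewrite (setIidPr sub) gS.
rewrite -[X in X == _]addn0 eqn_add2l eq_sym sum_nat_eq0 => /forall_inP/(_ F).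
rewrite inE nF Fq => /(_ isT); case/imsetP: Fq => d _ ->.
by rewrite (negPf (card_porbit_neq0 _ _)).
Qed.

Lemma tame_genus : genus phi = 0%R.
Proof. by rewrite -psi_plane /genus tame_card_faces. Qed.

End Main.

(** * Polyhedral embeddings and cubic embeddings with simple dual are tame *)

Lemma mem_orbit_porbit (T : finType) (s : {perm T}) x y :
  (y \in fingraph.orbit s x) = (y \in porbit s x).
Proof.
rewrite -fconnect_orbit; apply/idP/porbitP=> [xy|[n ->]].
  by exists (findex s x y); rewrite permX iter_findex.
by rewrite permX fconnect_iter.
Qed.

Lemma uniq_map_inj_in (T1 T2 : eqType) (f : T1 -> T2) (s : seq T1) :
  uniq (map f s) -> {in s &, injective f}.
Proof.
elim: s => //= x s IHs /andP[fx us] y z; rewrite !inE.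
case/predU1P=> [->|ys] /predU1P[->|zs] // fyz.
- by case/negP: fx; rewrite fyz map_f.
- by case/negP: fx; rewrite -fyz map_f.
exact: IHs.
Qed.

Section TameCriteria.
Variables (G : sgraph) (phi : embedding G).
Hypothesis G_neq1 : #|G| != 1.
Local Notation fp := (face_perm phi).
Implicit Types d e f : dart G.

Lemma polyhedral_tame : polyhedral phi -> tame phi.
Proof.
case=> cyc meet.
have porb d : porbit fp d \in faces phi by rewrite facesE // imset_f.
have orb d : 2 < size (fingraph.orbit fp d) /\ uniq (map (@dart_start G) (fingraph.orbit fp d)).
  have [|] := cyc (fingraph.orbit fp d).
    split; first by rewrite /ucycle cycle_orbit ?orbit_uniq //; apply: perm_inj.
    suff -> : [set e in fingraph.orbit fp d] = porbit fp d by [].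
    by apply/setP=> e; rewrite inE mem_orbit_porbit.
  by rewrite size_map => sz /andP[].
have simp d e : e \in porbit fp d -> dart_start e = dart_start d -> e = d.
  rewrite -mem_orbit_porbit => ed.
  have [_ /uniq_map_inj_in inj] := orb d.
  by move=> st; apply: inj st; rewrite // mem_orbit_porbit porbit_id.
(* By simplicity, a face running through an edge both ways would consist of these two darts only,
   but its length exceeds 2. *)
have loop d : dart_rev d \notin porbit fp d.
  apply/negP=> rd.
  have fd : dart_rev d = fp d.
    by apply: simp; rewrite ?porbit_permEr // dart_start_face_perm.
  have fr : fp (dart_rev d) = d.
    by apply: simp; rewrite ?porbit_permE // dart_start_face_perm.
  have [sz _] := orb d.
  have : #|fingraph.orbit fp d| <= #|[set d; dart_rev d]|.
    apply: subset_leq_card; apply/subsetP=> e; rewrite mem_orbit_porbit => ed.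
    elim/porbit_ind: e / ed => [|e _ /set2P[]->]; rewrite ?set21 //.
      by rewrite -fd set22.
    by rewrite fr set21.
  by rewrite (card_uniqP (orbit_uniq _ _)) cards2 leqNgt (leq_trans _ sz) //; case: (_ != _).
have edgeP (A : {set dart G}) d : d \in A -> dart_edge d \in face_edges A by apply: imset_f.
have startP (A : {set dart G}) d : d \in A -> dart_start d \in face_vertices A by apply: imset_f.
split=> // [d e ed re|f f' d d' f'f d'd fd f'd' Xd Xd'].
  have dE : dart_edge d \in face_edges (porbit fp d) :&: face_edges (porbit fp (dart_rev d)).
    by rewrite inE edgeP ?porbit_id // -dart_edge_rev edgeP ?porbit_id.
  have eE : dart_edge e \in face_edges (porbit fp d) :&: face_edges (porbit fp (dart_rev d)).
    by rewrite inE edgeP // -dart_edge_rev edgeP.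
  have /meet[] // : porbit fp d != porbit fp (dart_rev d).
    by rewrite eq_sym eq_porbit_mem loop.
  - by case=> _ E0; rewrite E0 inE in dE.
  - by case=> v [_ E0]; rewrite E0 inE in dE.
  case=> u [v [_ _ EE]]; move: dE eE; rewrite EE => /set1P<- /set1P/eqP.
  rewrite dart_edgeP => /orP[]/eqP // er.
  by case/negP: (loop d); rewrite -er.
have ff : f \in porbit fp f by apply: porbit_id.
have dd : d \in porbit fp d by apply: porbit_id.
have sV : dart_start d \in face_vertices (porbit fp f) :&: face_vertices (porbit fp d).
  by rewrite inE -{1}fd !startP.
have s'V : dart_start d' \in face_vertices (porbit fp f) :&: face_vertices (porbit fp d).
  by rewrite inE -{1}f'd' !startP.
have /meet[] // : porbit fp f != porbit fp d.
  by rewrite eq_sym eq_porbit_mem; apply: contra Xd; rewrite /along => ->.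
- by case=> V0 _; rewrite V0 inE in sV.
- by case=> v [V1 _]; move: sV s'V; rewrite V1 => /set1P sd /set1P sd'; apply: simp; rewrite ?sd.
case=> u [v [_ VV EE]].
have : [set u; v] \in face_edges (porbit fp f) :&: face_edges (porbit fp d) by rewrite EE set11.
case/setIP=> /imsetP[b bF bE] /imsetP[a aH aE].
have Xa : along phi f a.
  have : dart_edge a == dart_edge b by rewrite -aE bE.
  by rewrite dart_edgeP => /orP[]/eqP->; rewrite ?along_rev /along bF.
(* Here the faces share just the edge of [a]. The dart of the second face at the start of [a] is [a]
   itself, so that face can leave the cycle only at the target of [a]. *)
have off e : e \in porbit fp d -> dart_start e \in [set u; v] ->
    ~~ along phi f e -> dart_start e = dart_target a.
  move=> eH; rewrite aE => /set2P[] // ea; rewrite (simp a e) ?Xa //.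
  exact: porbit_euclid eH aH.
rewrite VV in sV s'V; apply: simp => //.
exact: etrans (off d' d'd s'V Xd') (esym (off d dd sV Xd)).
Qed.

Lemma mends_dual d : @mends (dual phi) (edge_of d) =
  [set face_of phi G_neq1 d; face_of phi G_neq1 (dart_rev d)].
Proof.
apply/setP=> F; have [f ->] := face_ofP G_neq1 F.
rewrite in_set in_set2 !face_of_eq /=; apply/exists_inP/orP=> [[e ef]|[] fd].
- by rewrite dart_edgeP => /orP[]/eqP ed; [left|right]; rewrite porbit_sym -ed.
- by exists d; rewrite // porbit_sym.
- by exists (dart_rev d); rewrite ?dart_edge_rev // porbit_sym.
Qed.

(** The rotation at a vertex is a 3-cycle, so any two distinct darts there are consecutive in one of
    the two orders. *)
Lemma cubic_nx d e : cubic G -> dart_start e = dart_start d -> e != d ->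
  e = nx phi d \/ d = nx phi e.
Proof.
move=> cub ed e_d.
have deg : #|porbit (nx phi) d| = 3.
  rewrite -(cub (dart_start d)).
  have <- : (@dart_target G) @: porbit (nx phi) d = [set y | adj (dart_start d) y].
    apply/setP=> y; rewrite inE; apply/imsetP/idP=> [[a]|dy].
      by rewrite nx_porbit => /eqP<- ->; apply: (valP a).
    exists (exist (fun p => adj p.1 p.2) (dart_start d, y) dy) => //.
    by rewrite nx_porbit.
  rewrite card_in_imset // => a b; rewrite !nx_porbit => /eqP sa /eqP sb.
  by apply: dart_ends_inj; rewrite sa.
have := iter_porbit (nx phi) d; rewrite deg /= => n3.
have : e \in porbit (nx phi) d by rewrite nx_porbit ed.
rewrite porbit_traject deg /= !inE (negPf e_d) /= => /orP[]/eqP->; first by left.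
by right; rewrite n3.
Qed.

(** Absence of loops and of parallel edges in the dual gives [tame_no_loop] and [tame_edge]. The
    other two conditions reduce to these, because two edges at a cubic vertex always bound a common
    corner. *)
Lemma cubic_simple_dual_tame : cubic G -> simple_multigraph (dual phi) -> tame phi.
Proof.
move=> cub [noloop inj].
have loop d : dart_rev d \notin porbit fp d.
  have := noloop (edge_of d); rewrite mends_dual; apply: contra => rd.
  suff -> : face_of phi G_neq1 (dart_rev d) = face_of phi G_neq1 d by rewrite setUid cards1.
  by apply/eqP; rewrite face_of_eq.
have edge d e : e \in porbit fp d -> dart_rev e \in porbit fp (dart_rev d) -> e = d.
  move=> ed re.
  have /inj/(congr1 val)/eqP :
      @mends (dual phi) (edge_of e) = @mends (dual phi) (edge_of d).
    rewrite !mends_dual; congr [set _; _]; apply/eqP;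
    by rewrite face_of_eq.
  rewrite /= dart_edgeP => /orP[]/eqP // er.
  by case/negP: (loop d); rewrite -er.
have nx_mem d e : nx phi d \in porbit fp e -> dart_rev d \in porbit fp e.
  by rewrite -face_perm_rev porbit_permE.
split=> // [d e ed st|f f' d d' f'f d'd fd f'd' Xd Xd'].
  apply/eqP; apply: contraT => /(cubic_nx cub st)[eE|dE].
    by case/negP: (loop d); apply: nx_mem; rewrite -eE.
  by case/negP: (loop e); apply: nx_mem; rewrite -dE porbit_sym.
(* The alternative order [a = nx phi b] would put [dart_rev b] on the face of [f]. *)
have nxoff a b : dart_start a = dart_start b -> a \in porbit fp f -> ~~ along phi f b ->
    b = nx phi a.
  move=> ab aF Xb; have b_a : b != a.
    by apply: contraNneq Xb => ->; rewrite /along aF.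
  have [//|aE] := cubic_nx cub (esym ab) b_a.
  by case/negP: Xb; rewrite /along nx_mem ?orbT // -aE.
have off a b : dart_start a = dart_start b -> a \in porbit fp f -> ~~ along phi f b ->
    dart_rev a \in porbit fp b.
  by move=> ab aF Xb; apply: nx_mem; rewrite -(nxoff _ _ ab aF Xb) porbit_id.
(* At both contacts the face of [d] lies across the cycle edge, so [f] and [f'] separate the same
   two faces and must coincide. *)
have rf : dart_rev f \in porbit fp d by apply: off; rewrite ?porbit_id.
have rf' : dart_rev f' \in porbit fp d by apply: porbit_trans d'd; apply: off.
have ff' : f' = f by apply: edge => //; apply: porbit_euclid rf' rf.
by rewrite (nxoff _ _ f'd' f'f Xd') (nxoff _ _ fd (porbit_id _ _) Xd) ff'.
Qed.

End TameCriteria.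

Theorem mainTheorem2 (G : sgraph) (hconn : connected_graph G)
    (hplanar : planar G) :
  (forall phi : embedding G, polyhedral phi -> genus phi = 0%R) /\
  (cubic G ->
   forall phi : embedding G, simple_multigraph (dual phi) -> genus phi = 0%R).
Proof.
case: hplanar => psi psi0.
have plane (phi : embedding G) : (#|G| != 1 -> tame phi) -> genus phi = 0%R.
  have [G1 _|G1 tam] := boolP (#|G| == 1); first exact/genus_card1/eqP.
  exact: tame_genus hconn G1 psi0 (tam isT).
split=> [phi poly|cub phi simple]; apply: plane => G1.
  exact: polyhedral_tame.
exact: cubic_simple_dual_tame.
Qed.
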